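(* Let $\chi$ be a finite alphabet and let $(X_n)_{n\ge 1}$ be a stationary and ergodic source with values in $\chi$, of entropy $H$. Let $\gamma:\chi^{*}\to\{0,1\}^{*}$ be any one-to-one code sequence. Then, for almost every realization $(x_n)_{n\ge1}$ of the source (almost surely with respect to the law of the source), $$\liminf_{n\to\infty}\frac{\|\gamma((x_1,\ldots,x_n))\|}{n}\ \geq\ H.$$
   Context: For a finite set $\chi$, $\chi^{n}$ is the set of sequences of length $n$ of elements of $\chi$, and $\chi^{*}=\bigcup_{n=0}^{\infty}\chi^{n}$; likewise $\{0,1\}^{*}$ is the set of all finite binary strings. $\|w\|$ denotes the length of a finite sequence $w$. A (binary) one-to-one code sequence (also called faithful-code sequence) is any function $\gamma:\chi^{*}\to\{0,1\}^{*}$ such that, for every integer $n$, the restriction of $\gamma$ to $\chi^{n}$ is injective. No prefix-freeness is required, and $\gamma$ need not be injective on all of $\chi^{*}$. A source is a stochastic process $(X_n)_{n\ge1}$ with values in $\chi$; write $p(x_1,\ldots,x_n)=\Pr(X_1=x_1,\ldots,X_n=x_n)$. It is stationary (respectively, ergodic) if its law on $\chi^{\mathbb{N}}$ is invariant (respectively, ergodic) under the shift. The entropy of a stationary source is its entropy rate with base-2 logarithms: $$H=\lim_{n\to\infty}-\frac1n\sum_{(x_1,\ldots,x_n)\in\chi^{n}}p(x_1,\ldots,x_n)\log_2 p(x_1,\ldots,x_n),$$ with the convention $0\log_2 0=0$. *)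

(* Defs.v *)
From HB Require Import structures.
From mathcomp Require Import all_boot all_order all_algebra.
From mathcomp Require Import all_classical all_reals all_analysis.

Set Implicit Arguments.
Unset Strict Implicit.
Unset Printing Implicit Defensive.

Import Order.TTheory GRing.Theory Num.Theory.
Import numFieldNormedType.Exports.

Local Open Scope classical_set_scope.
Local Open Scope ring_scope.

(* No injectivity is required across different lengths, and no prefix
   condition. *)
Definition one_to_one_code (chi : finType) (gamma : seq chi -> seq bool) : Prop :=
  forall n : nat, injective (fun t : n.-tuple chi => gamma t).

Definition shift (chi : finType) (x : nat -> chi) : nat -> chi :=
  fun n => x n.+1.

Definition cylinders (chi : finType) : set (set (nat -> chi)) :=
  [set A | exists (i : nat) (a : chi), A = [set x | x i = a]].

(* The product sigma-algebra of the discrete ones on chi, kept as a set of sets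
   because a [measurableType] would require chi to be pointed. *)
Definition seq_measurable (chi : finType) : set (set (nat -> chi)) :=
  <<s @cylinders chi >>.

(* Times are numbered from 0: [X i] is the random variable X_(i+1). *)
Definition is_source (d : measure_display) (T : measurableType d)
    (chi : finType) (X : nat -> T -> chi) : Prop :=
  forall (i : nat) (a : chi), measurable (X i @^-1` [set a]).

Definition realization (T : Type) (chi : finType) (X : nat -> T -> chi)
  (w : T) : nat -> chi := fun i => X i w.

(* The pushforward of P to chi^nat; meaningful on [seq_measurable] sets. *)
Definition law (R : realType) (d : measure_display) (T : measurableType d)
    (P : probability T R) (chi : finType) (X : nat -> T -> chi)
    (A : set (nat -> chi)) : \bar R :=
  P (realization X @^-1` A).

Definition stationary (R : realType) (d : measure_display)
    (T : measurableType d) (P : probability T R) (chi : finType)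
    (X : nat -> T -> chi) : Prop :=
  forall A : set (nat -> chi), seq_measurable A ->
    law P X (@shift chi @^-1` A) = law P X A.

Definition ergodic (R : realType) (d : measure_display)
    (T : measurableType d) (P : probability T R) (chi : finType)
    (X : nat -> T -> chi) : Prop :=
  forall A : set (nat -> chi), seq_measurable A ->
    @shift chi @^-1` A = A -> law P X A = 0%E \/ law P X A = 1%E.

Definition word_prob (R : realType) (d : measure_display)
    (T : measurableType d) (P : probability T R) (chi : finType)
    (X : nat -> T -> chi) (n : nat) (t : n.-tuple chi) : R :=
  fine (P [set w | forall i : 'I_n, X i w = tnth t i]).

Definition log2 (R : realType) (x : R) : R := ln x / ln 2.

(* Since 0 * _ = 0, words of probability 0 contribute 0, as intended. *)
Definition block_entropy (R : realType) (d : measure_display)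
    (T : measurableType d) (P : probability T R) (chi : finType)
    (X : nat -> T -> chi) (n : nat) : R :=
  - \sum_(t : n.-tuple chi) word_prob P X t * log2 (word_prob P X t).

(* [limn] is a total operator; the limit exists for every stationary source. *)
Definition entropy (R : realType) (d : measure_display)
    (T : measurableType d) (P : probability T R) (chi : finType)
    (X : nat -> T -> chi) : R :=
  limn (fun n : nat => block_entropy P X n / n%:R).

(* Main.v *)
(* The heart of the matter is that a.s. p(X_1..X_n) < exp(-nc) eventually, for every
   0 <= c < H ln 2. Granted this, let 0 <= a < c: at most 2 exp(na) words have a
   codeword of at most na / ln 2 bits, so the probability that X_1..X_n is such a
   word and has p < exp(-nc) is summable in n, and Borel-Cantelli concludes.

   If the bound failed for c, then by ergodicity, for almost every x, infinitely
   many n would satisfy p(x_1..x_n) >= exp(-nc) (up to a constant factor). A long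
   word then splits, apart from a vanishing proportion of isolated letters, into
   blocks w with p(w) >= exp(-c|w|). A subprobability on words of length N that
   averages over all such parsings therefore gives a typical word mass at least
   exp(-N(c + o(1))), and Gibbs' inequality yields H ln 2 <= c. Probabilities of
   blocks are stationary, so the expected number of isolated letters is at most a
   sum of N probabilities tending to 0, and no ergodic theorem is needed. *)

Require Import Defs.
From HB Require Import structures.
From mathcomp Require Import all_boot all_order all_algebra.
From mathcomp Require Import all_classical all_reals all_analysis.
From mathcomp Require Import ring lra zify.

Set Implicit Arguments.
Unset Strict Implicit.
Unset Printing Implicit Defensive.

Import Order.TTheory GRing.Theory Num.Theory.
Import numFieldNormedType.Exports.

Local Open Scope classical_set_scope.
Local Open Scope ring_scope.

(** * Sums over words and entropy *)

Definition wsum (R : realType) (chi : finType) (n : nat) (F : seq chi -> R) : R :=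
  \sum_(t : n.-tuple chi) F t.

Section word_sums.
Variables (R : realType) (chi : finType).
Implicit Types F G : seq chi -> R.

Lemma eq_wsum n F G : (forall s, size s = n -> F s = G s) -> wsum n F = wsum n G.
Proof. by move=> FG; apply: eq_bigr => t _; rewrite FG ?size_tuple. Qed.

Lemma ler_wsum n F G : (forall s, size s = n -> F s <= G s) -> wsum n F <= wsum n G.
Proof. by move=> FG; apply: ler_sum => t _; rewrite FG ?size_tuple. Qed.

Lemma wsum_ge0 n F : (forall s, 0 <= F s) -> 0 <= wsum n F.
Proof. by move=> F0; apply: sumr_ge0. Qed.

Lemma wsumZ n (a : R) F : wsum n (fun s => a * F s) = a * wsum n F.
Proof. by rewrite /wsum mulr_sumr. Qed.

Lemma wsumD n F G : wsum n (fun s => F s + G s) = wsum n F + wsum n G.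
Proof. exact: big_split. Qed.

Lemma wsumN n F : wsum n (fun s => - F s) = - wsum n F.
Proof. exact: sumrN. Qed.

Lemma wsum_sum n (I : Type) (r : seq I) (P : pred I) (F : I -> seq chi -> R) :
  wsum n (fun s => \sum_(i <- r | P i) F i s) = \sum_(i <- r | P i) wsum n (F i).
Proof. exact: exchange_big. Qed.

Lemma wsum0 F : wsum 0 F = F [::].
Proof.
rewrite /wsum (bigD1 [tuple])//= big1 ?addr0// => t /negP[]; exact/eqP/tuple0.
Qed.

Lemma wsumS n F : wsum n.+1 F = \sum_(a : chi) wsum n (fun s => F (a :: s)).
Proof.
rewrite /wsum pair_big /=.
rewrite (reindex (fun u : chi * n.-tuple chi => [tuple of u.1 :: u.2])) //.
exists (fun t : n.+1.-tuple chi => (thead t, [tuple of behead t])).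
  by move=> [a t] _ /=; congr (_, _); apply: val_inj.
by move=> t _ /=; rewrite -tuple_eta.
Qed.

Lemma wsum_cat n m F :
  wsum (n + m) F = wsum n (fun s => wsum m (fun s' => F (s ++ s'))).
Proof.
elim: n F => [|n IH] F; first by rewrite wsum0.
by rewrite addSn !wsumS; apply: eq_bigr => a _; rewrite IH.
Qed.

Lemma wsumS_behead n F : wsum n.+1 (fun s => F (behead s)) = #|chi|%:R * wsum n F.
Proof. by rewrite wsumS /= sumr_const mulr_natl. Qed.

Lemma wsum_take_drop n N F G : (n <= N)%N ->
  wsum N (fun s => F (take n s) * G (drop n s)) = wsum n F * wsum (N - n) G.
Proof.
move=> nN; rewrite -{1}(subnKC nN) wsum_cat mulrC -wsumZ.
apply: eq_wsum => s ss; rewrite mulrC -wsumZ; apply: eq_wsum => s' _.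
by rewrite -ss take_size_cat// drop_size_cat.
Qed.

End word_sums.

(** Sum [ln x <= x - 1] at [x = q i / p i] against [p]. A subprobability [q] is allowed, as the
    mixture below is one. Positivity of [q] where [p] is positive is essential since [ln 0 = 0] by
    convention. *)
Lemma gibbs (R : realType) (I : finType) (p q : I -> R) :
  (forall i, 0 <= p i) -> (forall i, 0 <= q i) ->
  \sum_i p i = 1 -> \sum_i q i <= 1 -> (forall i, 0 < p i -> 0 < q i) ->
  - (\sum_i p i * ln (p i)) <= - (\sum_i p i * ln (q i)).
Proof.
move=> p0 q0 p1 q1 pq; rewrite lerN2 -subr_le0 -sumrB.
apply: (@le_trans _ _ (\sum_i (q i - p i))); last by rewrite sumrB p1 subr_le0.
apply: ler_sum => i _; rewrite -mulrBr.
have := p0 i; rewrite le_eqVlt => /predU1P[<-|pi0]; first by rewrite mul0r subr0.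
rewrite -ln_div ?posrE ?pq//.
have -> : q i - p i = p i * (q i / p i - 1).
  by rewrite mulrBr mulr1 mulrCA divff ?mulr1// gt_eqF.
rewrite ler_pM2l//.
have := @le_ln1Dx R (q i / p i - 1); rewrite addrCA subrr addr0; apply.
by rewrite ltrBDr addNr divr_gt0// pq.
Qed.

Lemma gibbs_wsum (R : realType) (chi : finType) n (p q : seq chi -> R) :
  (forall s, 0 <= p s) -> (forall s, 0 <= q s) ->
  wsum n p = 1 -> wsum n q <= 1 ->
  (forall s, size s = n -> 0 < p s -> 0 < q s) ->
  - wsum n (fun s => p s * ln (p s)) <= - wsum n (fun s => p s * ln (q s)).
Proof.
move=> p0 q0 p1 q1 pq.
apply: (@gibbs R _ (fun t : n.-tuple chi => p t) (fun t => q t)) => // t.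
by apply: pq; rewrite size_tuple.
Qed.

(** * Subadditive sequences *)

Lemma subadditive_mulnD (R : realType) (a : nat -> R) :
  (forall n m, a (n + m)%N <= a n + a m) ->
  forall q k r, a (q * k + r)%N <= q%:R * a k + a r.
Proof.
move=> aD; elim=> [|q IH] k r; first by rewrite mul0r add0r.
rewrite mulSn -addnA (le_trans (aD _ _))// -natr1 mulrDl mul1r.
by rewrite [q%:R * _ + _]addrC -addrA lerD2l IH.
Qed.

Lemma fekete (R : realType) (a : nat -> R) :
  (forall n, 0 <= a n) -> (forall n m, a (n + m)%N <= a n + a m) ->
  cvgn (fun n => a n / n%:R).
Proof.
move=> a0 aD; set u := fun n => a n / n%:R.
(* The limit is the infimum over positive indices; [u 0] is 0 by the convention on division and must
   be left out. *)
pose S := [set u k.+1 | k in setT].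
have S0 : S !=set0 by exists (u 1%N), 0%N.
have Slb : has_lbound S.
  by exists 0 => _ [k _ <-]; rewrite divr_ge0// ler0n.
have Sinf : has_inf S by split.
have lb k : inf S <= u k.+1 by apply: ge_inf => //; exists k.
apply/cvg_ex; exists (inf S); apply/cvgrPdist_le => e e0.
have e20 : 0 < e / 2 by rewrite divr_gt0.
have [_ [k _ <-] uk] := inf_adherent e20 Sinf.
(* [C] bounds [a r] for every remainder [r] modulo [k.+1], uniformly in [n]. *)
pose C := \sum_(r < k.+1) a r.
near=> n; have n0 : (0 < n)%N by near: n; exists 1%N.
have nC : C / (e / 2) <= n%:R by near: n; exact: nbhs_infty_ger.
have n0R : 0 < n%:R :> R by rewrite ltr0n.
have u_le : u n <= u k.+1 + e / 2.
  have ->: u n = a ((n %/ k.+1) * k.+1 + n %% k.+1)%N / n%:R by rewrite -divn_eq.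
  rewrite ler_pdivrMr// mulrDl.
  apply: (le_trans (subadditive_mulnD aD _ _ _)); apply: lerD; last first.
    apply: (@le_trans _ _ C); last by rewrite mulrC -ler_pdivrMr.
    have rk : (n %% k.+1 < k.+1)%N by rewrite ltn_mod.
    rewrite /C (bigD1 (Ordinal rk))//= lerDl sumr_ge0// => i _; exact: a0.
  rewrite /u mulrC -mulrA ler_wpM2l ?a0// mulrC ler_pdivlMr ?ltr0n//.
  by rewrite -natrM ler_nat leq_divM.
have [j nj] : exists j, n = j.+1 by exists n.-1; rewrite prednK.
rewrite -/u nj in u_le *; have := lb j.
move=> lbj; rewrite ler_distl; apply/andP; split; lra.
Unshelve. all: by end_near.
Qed.

(** * Entropy of a stationary distribution on words *)

Definition wentropy (R : realType) (chi : finType) (p : seq chi -> R) (n : nat) : R :=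
  - wsum n (fun s => p s * ln (p s)).

Section word_distribution.
Variables (R : realType) (chi : finType) (p : seq chi -> R).
Hypothesis p_ge0 : forall s, 0 <= p s.
Hypothesis p_nil : p [::] = 1.
Hypothesis p_cons : forall s, \sum_(a : chi) p (a :: s) = p s.
Hypothesis p_rcons : forall s, \sum_(a : chi) p (rcons s a) = p s.

Lemma wsum_marginr m s : wsum m (fun s' => p (s' ++ s)) = p s.
Proof.
elim: m => [|m IH]; first by rewrite wsum0.
rewrite wsumS -wsum_sum -[RHS]IH; apply: eq_wsum => s' _ /=; exact: p_cons.
Qed.

Lemma wsum_marginl m s : wsum m (fun s' => p (s ++ s')) = p s.
Proof.
elim: m s => [|m IH] s; first by rewrite wsum0 cats0.
rewrite wsumS -[RHS]p_rcons; apply: eq_bigr => a _; rewrite -IH.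
by apply: eq_wsum => s' _; rewrite cat_rcons.
Qed.

Lemma wsum_prob n : wsum n p = 1.
Proof. by rewrite -p_nil -(wsum_marginl n). Qed.

Lemma wsum_take n m F : wsum (n + m) (fun s => p s * F (take n s)) =
  wsum n (fun s => p s * F s).
Proof.
rewrite wsum_cat; apply: eq_wsum => s ss; rewrite mulrC.
rewrite -(wsum_marginl m) -wsumZ; apply: eq_wsum => s' _.
by rewrite mulrC -ss take_size_cat.
Qed.

Lemma wsum_drop n m F : wsum (n + m) (fun s => p s * F (drop n s)) =
  wsum m (fun s => p s * F s).
Proof.
rewrite wsum_cat.
transitivity (wsum m (fun s' => wsum n (fun s => p (s ++ s') * F (drop n (s ++ s'))))).
  exact: exchange_big.
apply: eq_wsum => s ss; rewrite mulrC.
rewrite -(wsum_marginr n) -wsumZ; apply: eq_wsum => s' ss'.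
by rewrite mulrC -ss' drop_size_cat.
Qed.

Lemma prob_catl s s' : p (s ++ s') <= p s.
Proof.
rewrite -(wsum_marginl (size s') s) /wsum (bigD1 (in_tuple s'))//= lerDl.
exact: sumr_ge0.
Qed.

Lemma prob_catr s s' : p (s ++ s') <= p s'.
Proof.
rewrite -(wsum_marginr (size s) s') /wsum (bigD1 (in_tuple s))//= lerDl.
exact: sumr_ge0.
Qed.

Lemma prob_le1 s : p s <= 1.
Proof. by rewrite -p_nil -(cats0 s) prob_catr. Qed.

Lemma wentropy_ge0 n : 0 <= wentropy p n.
Proof.
rewrite oppr_ge0 -oppr_ge0 -wsumN; apply: wsum_ge0 => s.
by rewrite -mulrN mulr_ge0// oppr_ge0 ln_le0// prob_le1.
Qed.

(** Gibbs' inequality against the law [q] that makes the first [n] and the last [m] letters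
    independent; by stationarity both marginals are again given by [p]. *)
Lemma wentropyD n m : wentropy p (n + m) <= wentropy p n + wentropy p m.
Proof.
pose q s := p (take n s) * p (drop n s).
have pq s : 0 < p s -> 0 < p (take n s) /\ 0 < p (drop n s).
  rewrite -{1}(cat_take_drop n s) => ps.
  by split; apply: lt_le_trans ps _; rewrite ?prob_catl ?prob_catr.
have q1 : wsum (n + m) q <= 1.
  by rewrite wsum_take_drop ?leq_addr// addKn !wsum_prob mulr1.
apply: le_trans (gibbs_wsum p_ge0 _ (wsum_prob _) q1 _) _.
- by move=> s; rewrite mulr_ge0.
- by move=> s _ /pq[? ?]; rewrite mulr_gt0.
rewrite -opprD lerN2 -(wsum_take n m) -(wsum_drop n m) -wsumD.
rewrite le_eqVlt; apply/orP; left; apply/eqP; apply: eq_wsum => s _; rewrite -mulrDr.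
have := p_ge0 s; rewrite le_eqVlt => /predU1P[<-|/pq[? ?]]; first by rewrite !mul0r.
by rewrite lnM.
Qed.

(** * The mixture over parsings into blocks and letters *)

Variables (c eps : R) (m : nat).
Hypotheses (c_ge0 : 0 <= c) (eps_gt0 : 0 < eps) (m_gt0 : (0 < m)%N).
Hypothesis tail_half :
  forall N, \sum_(m <= n < N) expR (- (eps * n%:R)) <= 2^-1.
Hypothesis chi_gt0 : (0 < #|chi|)%N.

Definition likely (s : seq chi) : bool :=
  [exists n : 'I_(size s).+1,
    (m <= n)%N && (expR (- (c * n%:R)) <= p (take n s))].

(** Bounds the number of isolated letters in a greedy parsing. Positions inside a block are counted
    as well, which makes the expectation a plain sum over positions. *)
Fixpoint unlikely_count (s : seq chi) : nat :=
  if s is _ :: s' then (~~ likely s + unlikely_count s')%N else 0%N.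

Let K : R := 2 * #|chi|%:R.

(* The average, over all parsings of [s] into single letters and blocks of length
   at least [m], of the product of the weights [1 / #|chi|] of the letters and [p w]
   of the blocks [w]; at each step a letter is chosen with probability 1/2 and a
   block of length n with probability [expR (- eps * n)], which [tail_half] makes a
   subprobability. The argument [f] is fuel. *)
Fixpoint mixture (f : nat) (s : seq chi) : R :=
  if s is _ :: s' then
    if f is f'.+1 then
      K^-1 * mixture f' s' +
      \sum_(m <= n < (size s).+1)
        expR (- (eps * n%:R)) * (p (take n s) * mixture f' (drop n s))
    else 0
  else 1.

Let K_gt0 : 0 < K. Proof. by rewrite mulr_gt0 ?ltr0n. Qed.

Lemma mixture_ge0 f s : 0 <= mixture f s.
Proof.
elim: f s => [|f IH] [|a s] //=.
rewrite addr_ge0 ?mulr_ge0 ?invr_ge0 ?(ltW K_gt0)//.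
by apply: sumr_ge0 => n _; rewrite !mulr_ge0 ?expR_ge0.
Qed.

(** By induction on the fuel, the letter branch and the block branch each have mass at most 1/2, the
    latter by [tail_half]. *)
Lemma wsum_mixture_le1 f N : wsum N (mixture f) <= 1.
Proof.
elim: f N => [|f IH] [|N]; rewrite ?wsum0//.
  rewrite (_ : wsum _ _ = 0) ?ler01// wsumS big1// => a _.
  by rewrite /wsum big1.
(* On words of length [N.+1], [G] is the unfolded mixture with a summation range free of [s], so
   that the sums can be exchanged. *)
pose G s := K^-1 * mixture f (behead s) + \sum_(m <= n < N.+2)
  expR (- (eps * n%:R)) * (p (take n s) * mixture f (drop n s)).
have -> : wsum N.+1 (mixture f.+1) = wsum N.+1 G.
  by apply: eq_wsum => -[|a s] //= [ss]; rewrite /G /= ss.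
rewrite wsumD wsumZ wsumS_behead wsum_sum.
rewrite [leRHS](_ : 1 = 2^-1 + 2^-1); last by lra.
apply: lerD.
  have -> : K^-1 * (#|chi|%:R * wsum N (mixture f)) = 2^-1 * wsum N (mixture f).
    by rewrite /K; field; rewrite pnatr_eq0 -lt0n.
  by rewrite -[leRHS]mulr1 ler_wpM2l.
apply: le_trans (tail_half N.+2).
rewrite big_nat [leRHS]big_nat; apply: ler_sum => n /andP[_ nN].
rewrite wsumZ wsum_take_drop// wsum_prob mul1r.
by rewrite -[leRHS]mulr1 ler_wpM2l ?expR_ge0.
Qed.

Lemma unlikely_count_drop n s : (unlikely_count (drop n s) <= unlikely_count s)%N.
Proof.
elim: n s => [|n IH] [|a s]; rewrite ?drop0//=.
by rewrite (leq_trans (IH s))// leq_addl.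
Qed.

(** Keep only the greedy parsing: a block wherever one can start, a letter elsewhere. A block of
    length [n] costs a factor at least [expR (- ((c + eps) * n))], a letter costs [K^-1]. *)
Lemma mixture_ge f s : (size s <= f)%N ->
  expR (- ((c + eps) * (size s)%:R + ln K * (unlikely_count s)%:R)) <= mixture f s.
Proof.
have lnK_ge0 : 0 <= ln K.
  by rewrite ln_ge0// /K -natrM ler1n muln_gt0.
elim: f s => [|f IH] [|a s]; rewrite ?mulr0 ?addr0 ?oppr0 ?expR0//.
move=> sf; rewrite [mixture _ _]/=; have [lk|ulk] := boolP (likely (a :: s)).
- move: (lk) => /existsP[[n /= nlt] /andP[mn cn]].
  have {}nlt : (n <= size (a :: s))%N by [].
  apply: ler_wpDl; first by rewrite mulr_ge0 ?invr_ge0 ?(ltW K_gt0) ?mixture_ge0.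
  rewrite (bigD1_seq n) ?mem_index_iota ?iota_uniq ?mn//.
  apply: ler_wpDr.
    by apply: sumr_ge0 => i _; rewrite !mulr_ge0 ?expR_ge0 ?mixture_ge0.
  (* Blocks are nonempty by [m_gt0], so each step of the parsing shortens the word and the fuel
     suffices. *)
  have dn : (size (drop n (a :: s)) <= f)%N by rewrite size_drop; move: sf => /=; lia.
  apply: le_trans (ler_wpM2l (expR_ge0 _)
    (ler_pM (expR_ge0 _) (expR_ge0 _) cn (IH _ dn))).
  rewrite -!expRD ler_expR size_drop natrB//.
  have := unlikely_count_drop n (a :: s); rewrite -(ler_nat R).
  move=> /(ler_wpM2l lnK_ge0) h.
  by rewrite -/(size (a :: s)) -/(unlikely_count (a :: s)); lra.
- apply: ler_wpDr.
    by apply: sumr_ge0 => i _; rewrite !mulr_ge0 ?expR_ge0 ?mixture_ge0.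
  have KV : K^-1 = expR (- ln K) by rewrite expRN lnK.
  rewrite KV; apply: le_trans (ler_wpM2l (expR_ge0 _) (IH s sf)).
  rewrite -expRD ler_expR /= ulk natrD -[(size s).+1%:R]natr1 mulr1n.
  have ce : 0 <= c + eps by rewrite addr_ge0// ltW.
  lra.
Qed.

Definition unlikely_prob (n : nat) : R := wsum n (fun s => p s * (~~ likely s)%:R).

(** Linearity of expectation: by stationarity the suffix of length [n.+1] is distributed as a word
    of length [n.+1]. *)
Lemma wsum_unlikely_count N : wsum N (fun s => p s * (unlikely_count s)%:R) =
  \sum_(n < N) unlikely_prob n.+1.
Proof.
elim: N => [|N IH]; first by rewrite wsum0 big_ord0 mulr0.
rewrite big_ord_recr /= -IH addrC -(wsum_drop 1 N) add1n /unlikely_prob -wsumD.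
by apply: eq_wsum => -[|a s] //= _; rewrite drop0 natrD mulrDr.
Qed.

(** Gibbs' inequality against the mixture, followed by the pointwise bound [mixture_ge]. *)
Lemma wentropy_le N :
  wentropy p N <= (c + eps) * N%:R + ln K * \sum_(n < N) unlikely_prob n.+1.
Proof.
apply: le_trans (gibbs_wsum p_ge0 (mixture_ge0 N) (wsum_prob N)
  (wsum_mixture_le1 N N) _) _.
  by move=> s ss _; apply: lt_le_trans (mixture_ge _); rewrite ?expR_gt0 ?ss.
have -> : (c + eps) * N%:R = wsum N (fun s => (c + eps) * N%:R * p s).
  by rewrite wsumZ wsum_prob mulr1.
rewrite -wsum_unlikely_count -wsumZ -wsumD.
rewrite -wsumN; apply: ler_wsum => s ss; rewrite -mulrN.
have -> : (c + eps) * N%:R * p s + ln K * (p s * (unlikely_count s)%:R) =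
  p s * ((c + eps) * N%:R + ln K * (unlikely_count s)%:R) by ring.
rewrite ler_wpM2l// lerNl -ler_expR -ss.
have := @mixture_ge N s; rewrite ss leqnn => /(_ isT) mx.
by rewrite lnK// posrE (lt_le_trans _ mx)// expR_gt0.
Qed.

End word_distribution.

(** * Passage to the entropy rate *)

Lemma geometric_sum_le (R : realType) (z : R) M N : 0 <= z < 1 ->
  \sum_(M <= n < N) z ^+ n <= z ^+ M / (1 - z).
Proof.
move=> /andP[z0 z1]; rewrite ler_pdivlMr ?subr_gt0// mulrC.
have [MN|NM] := leqP M N; last by rewrite big_geq ?mulr0 ?exprn_ge0// ltnW.
suff -> : (1 - z) * \sum_(M <= n < N) z ^+ n = z ^+ M - z ^+ N.
  by rewrite gerBl exprn_ge0.
elim: N MN => [|N IH]; first by rewrite leqn0 => /eqP ->; rewrite big_geq// mulr0 subrr.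
rewrite leq_eqVlt => /predU1P[<-|MN]; first by rewrite big_geq// mulr0 subrr.
by rewrite big_nat_recr//= mulrDr IH// [z ^+ N.+1]exprS; ring.
Qed.

Lemma geometric_tail_half (R : realType) (eps : R) : 0 < eps ->
  exists2 m, (0 < m)%N &
    forall N, \sum_(m <= n < N) expR (- (eps * n%:R)) <= 2^-1.
Proof.
move=> eps0; set z := expR (- eps).
have z0 : 0 < z := expR_gt0 _.
have z1 : z < 1 by rewrite expR_lt1 oppr_lt0.
have zn n : expR (- (eps * n%:R)) = z ^+ n.
  by rewrite -expRM_natl mulrN mulrC.
have : z ^+ n @[n --> \oo] --> 0 by apply: cvg_expr; rewrite gtr0_norm.
have z2 : 0 < (1 - z) / 2 by rewrite divr_gt0// subr_gt0.
move=> /cvgrPdist_le /(_ _ z2) [M _ HM].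
exists M.+1 => // N.
have {}HM : z ^+ M.+1 <= (1 - z) / 2.
  by have := HM M.+1 (leqnSn M); rewrite sub0r normrN ger0_norm// exprn_ge0// ltW.
under eq_bigr do rewrite zn.
apply: le_trans (geometric_sum_le _ _ _) _; first by rewrite (ltW z0).
by rewrite ler_pdivrMr ?subr_gt0// mulrC.
Qed.

(** Divide [wentropy_le] by the length: the Cesàro means of [unlikely_prob] vanish, and [eps] is
    arbitrary. *)
Lemma entropy_rate_le (R : realType) (chi : finType) (p : seq chi -> R) (c : R) :
  (forall s, 0 <= p s) -> p [::] = 1 ->
  (forall s, \sum_(a : chi) p (a :: s) = p s) ->
  (forall s, \sum_(a : chi) p (rcons s a) = p s) ->
  (0 < #|chi|)%N -> 0 <= c ->
  (forall m, unlikely_prob p c m n @[n --> \oo] --> 0) ->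
  limn (fun n => wentropy p n / n%:R) <= c.
Proof.
move=> p0 p1 pl pr chi0 c0 unlikely0; apply/ler_addgt0Pr => eps eps0.
have [m m0 mN] := geometric_tail_half eps0.
have cvgH : cvgn (fun n => wentropy p n / n%:R).
  by apply: fekete; [exact: wentropy_ge0|exact: wentropyD].
rewrite -cvg_shiftS in cvgH; rewrite -(cvg_lim _ cvgH)//.
set K : R := ln (2 * #|chi|%:R).
have : (c + eps) + K * arithmetic_mean (fun n => unlikely_prob p c m n.+1) n
         @[n --> \oo] --> (c + eps) + K * 0.
  apply: cvgD; first exact: cvg_cst.
  apply: cvgM; first exact: cvg_cst.
  by apply: cesaro; rewrite (cvg_shiftS (unlikely_prob p c m)).
rewrite mulr0 addr0 => cvgB; rewrite -(cvg_lim _ cvgB)//.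
apply: ler_lim; [exact: (cvgP _ cvgH)|exact: (cvgP _ cvgB)|].
apply: nearW => n; rewrite ler_pdivrMr ?ltr0n//.
apply: le_trans (wentropy_le p0 p1 pl pr c0 eps0 m0 mN chi0 n.+1) _.
rewrite /arithmetic_mean /series /= [leRHS]mulrDl lerD2l -mulrA big_mkord.
by rewrite [_^-1 * _]mulrC mulfVK ?pnatr_eq0.
Qed.

(** * The shift space and the law of the source *)

Section sequence_space.
Variable chi : finType.
Implicit Types A B : set (nat -> chi).

Lemma seq_measurableC A : seq_measurable A -> seq_measurable (~` A).
Proof. by move=> mA; rewrite -setTD; exact: sigma_algebraCD. Qed.

Lemma seq_measurable_bigcup (F : nat -> set (nat -> chi)) :
  (forall n, seq_measurable (F n)) -> seq_measurable (\bigcup_n F n).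
Proof. exact: sigma_algebra_bigcup. Qed.

Lemma seq_measurable_bigcap (F : nat -> set (nat -> chi)) :
  (forall n, seq_measurable (F n)) -> seq_measurable (\bigcap_n F n).
Proof.
move=> mF; rewrite -[X in seq_measurable X]setCK setC_bigcap.
apply: seq_measurableC; apply: seq_measurable_bigcup => n.
exact: seq_measurableC.
Qed.

Lemma seq_measurableI A B :
  seq_measurable A -> seq_measurable B -> seq_measurable (A `&` B).
Proof.
move=> mA mB; rewrite -bigcap2E; apply: seq_measurable_bigcap => -[|[|n]] //=.
rewrite -setC0; apply: seq_measurableC; exact: sigma_algebra0.
Qed.

Lemma seq_measurable_prefix (b : pred (seq chi)) n :
  seq_measurable [set x : nat -> chi | b (mkseq x n)].
Proof.
elim: n b => [|n IH] b.
  rewrite /mkseq /=; have [bn|bn] := boolP (b [::]).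
    rewrite (_ : [set _ | _] = ~` set0); last by rewrite setC0; apply/seteqP.
    by apply: seq_measurableC; exact: sigma_algebra0.
  rewrite (_ : [set _ | _] = set0); first exact: sigma_algebra0.
  by apply/seteqP; split.
(* Split on the last letter; [unpickle] turns the union over [chi] into one indexed by [nat]. *)
pose F k : set (nat -> chi) := if unpickle k is Some a then
  [set x | x n = a] `&` [set x | b (rcons (mkseq x n) a)] else set0.
have -> : [set x : nat -> chi | b (mkseq x n.+1)] = \bigcup_k F k.
  apply/seteqP; split => x /=; rewrite mkseqS.
    by move=> bx; exists (pickle (x n)) => //; rewrite /F pickleK.
  by move=> [k _]; rewrite /F; case: unpickle => // a [/= ->].
apply: seq_measurable_bigcup => k; rewrite /F.
case: unpickle => [a|]; last exact: sigma_algebra0.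
apply: seq_measurableI; last exact: (IH (fun s => b (rcons s a))).
by apply: sub_sigma_algebra; exists n, a.
Qed.

(** The sets with preimage in [G] form a sigma-algebra containing the cylinders. A bare set system
    [G] serves both the shift and the realization map. *)
Lemma seq_measurable_comap (U : Type) (G : set (set U)) (f : U -> nat -> chi) :
  sigma_algebra setT G -> (forall i a, G [set u | f u i = a]) ->
  forall A, seq_measurable A -> G (f @^-1` A).
Proof.
move=> [G0 GC GU] Gcyl A mA.
apply: (@smallest_sub _ _ _ [set B | G (f @^-1` B)] _ _ A mA) => /=.
  split => /= [|B GB|F GF].
  - by rewrite preimage_set0.
  - by rewrite setTD preimage_setC -setTD; exact: GC.
  - by rewrite preimage_bigcup; exact: GU.
by move=> _ [i [a ->]]; exact: Gcyl.
Qed.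

Lemma seq_measurable_shift A : seq_measurable A ->
  seq_measurable (@Defs.shift chi @^-1` A).
Proof.
apply: seq_measurable_comap; first exact: smallest_sigma_algebra.
by move=> i a; apply: sub_sigma_algebra; exists i.+1, a.
Qed.

Lemma mkseq_shift (x : nat -> chi) n : mkseq x n.+1 = x 0%N :: mkseq (Defs.shift x) n.
Proof. by rewrite /mkseq -add1n iotaD /= (iotaDl 1 0) -map_comp. Qed.

End sequence_space.

Lemma measure_fin_partition (R : realType) (d : measure_display)
    (T : measurableType d) (P : {measure set T -> \bar R}) (I : finType)
    (f : T -> I) (A : set T) :
  (forall i, measurable (A `&` f @^-1` [set i])) ->
  P A = (\sum_i P (A `&` f @^-1` [set i]))%E.
Proof.
move=> mf; have AE : A = \bigcup_(i in [set: I]) (A `&` f @^-1` [set i]).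
  by apply/seteqP; split => [x Ax|x [i _ []//]]; exists (f x).
rewrite {1}AE measure_fin_bigcup//; [|exact: finite_finset|].
  rewrite (fsbigE (enum I)) ?enum_uniq//; last by move=> i _; rewrite mem_enum.
  by rewrite big_enum_cond; apply: eq_bigl => i; rewrite in_setT.
apply/trivIsetP => i j _ _ /eqP ij; apply/seteqP; split => // x [[_ fi] [_ fj]].
by case: ij; rewrite -fi -fj.
Qed.

(** * Word probabilities of the source *)

Section source.
Variables (R : realType) (d : measure_display) (T : measurableType d).
Variables (P : probability T R) (chi : finType) (X : nat -> T -> chi).
Hypothesis X_source : is_source X.

Let x_ w := realization X w.

Lemma measurable_realization A : seq_measurable A ->
  measurable (realization X @^-1` A).
Proof.
apply: seq_measurable_comap; first exact: sigma_algebra_measurable.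
by move=> i a; exact: X_source.
Qed.

Lemma measurable_prefix (b : pred (seq chi)) n :
  measurable [set w | b (mkseq (x_ w) n)].
Proof. exact: (measurable_realization (seq_measurable_prefix b n)). Qed.

Definition prefix_prob (s : seq chi) : R :=
  fine (P [set w | mkseq (x_ w) (size s) == s]).

Lemma prefix_probE s :
  P [set w | mkseq (x_ w) (size s) == s] = (prefix_prob s)%:E.
Proof.
by rewrite fineK// fin_num_measure//; exact: (measurable_prefix (pred1 s)).
Qed.

Lemma prefix_prob_ge0 s : 0 <= prefix_prob s.
Proof. by rewrite fine_ge0. Qed.

Lemma prefix_prob_nil : prefix_prob [::] = 1.
Proof.
rewrite /prefix_prob (_ : [set _ | _] = setT) ?probability_setT//.
by apply/seteqP.
Qed.

Lemma prefix_prob_rcons s : \sum_(a : chi) prefix_prob (rcons s a) = prefix_prob s.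
Proof.
apply: EFin_inj; rewrite -prefix_probE -sumEFin.
have fE a : [set w | mkseq (x_ w) (size s) == s] `&` X (size s) @^-1` [set a] =
    [set w | mkseq (x_ w) (size (rcons s a)) == rcons s a].
  apply/seteqP; split => w /=; rewrite size_rcons mkseqS eqseq_rcons.
    by move=> [-> <-]; rewrite eqxx.
  by move=> /andP[-> /eqP].
rewrite (@measure_fin_partition _ _ _ P _ (X (size s))) => [|a]; last first.
  by rewrite fE; exact: (measurable_prefix (pred1 (rcons s a))).
by apply: eq_bigr => a _; rewrite fE -prefix_probE.
Qed.

Lemma word_prob_prefix n (t : n.-tuple chi) : word_prob P X t = prefix_prob t.
Proof.
rewrite /word_prob /prefix_prob size_tuple; congr (fine (P _)).
apply/seteqP; split => w /=.
  move=> wt; apply/eqP/(@eq_from_nth _ (X 0%N w)) => [|i];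
    rewrite size_mkseq ?size_tuple// => iN.
  by rewrite nth_mkseq// -[i]/(nat_of_ord (Ordinal iN)) -tnth_nth -wt.
move=> /eqP wt i; rewrite (tnth_nth (X i w)) -wt nth_mkseq//.
Qed.

Lemma wsum_prefix_prob n (b : pred (seq chi)) :
  P [set w | b (mkseq (x_ w) n)] = (wsum n (fun s => prefix_prob s * (b s)%:R))%:E.
Proof.
pose f w : n.-tuple chi := [tuple of mkseq (x_ w) n].
have fE t : [set w | b (mkseq (x_ w) n)] `&` f @^-1` [set t] =
  [set w | b t && (mkseq (x_ w) n == t)].
  apply/seteqP; split => w /=.
    by move=> [bw <-]; rewrite bw eqxx.
  by move=> /andP[bt /eqP wt]; split; [rewrite wt|apply: val_inj].
rewrite (@measure_fin_partition _ _ _ P _ (f)) => [|t]; last first.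
  by rewrite fE; exact: (measurable_prefix (fun s => b t && (s == t))).
rewrite /wsum -sumEFin; apply: eq_bigr => t _; rewrite fE.
case: (b t) => /=; last first.
  by rewrite mulr0 (_ : [set _ | _] = set0) ?measure0//; apply/seteqP; split.
by rewrite mulr1 -prefix_probE size_tuple.
Qed.

Hypothesis X_stationary : stationary P X.

(** By stationarity [s] is as likely to be read from time 1 as from time 0; the former event is
    partitioned by the letter at time 0. *)
Lemma prefix_prob_cons s : \sum_(a : chi) prefix_prob (a :: s) = prefix_prob s.
Proof.
pose A := [set x : nat -> chi | mkseq x (size s) == s].
have mA : seq_measurable A := seq_measurable_prefix (pred1 s) (size s).
apply: EFin_inj; rewrite -prefix_probE -[RHS](X_stationary mA) /law -sumEFin.
have fE a : realization X @^-1` (@Defs.shift chi @^-1` A) `&` X 0%N @^-1` [set a] =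
    [set w | mkseq (x_ w) (size (a :: s)) == a :: s].
  apply/seteqP; split => w; rewrite /A /= mkseq_shift eqseq_cons.
    by move=> [-> <-]; rewrite eqxx.
  by move=> /andP[/eqP <- ->].
rewrite (@measure_fin_partition _ _ _ P _ (X 0%N)) => [|a]; last first.
  by rewrite fE; exact: (measurable_prefix (pred1 (a :: s)) (size (a :: s))).
by apply: eq_bigr => a _; rewrite fE -prefix_probE.
Qed.

Let p_marginl := prefix_prob_cons.
Let p_marginr := prefix_prob_rcons.
Let p_ge0 := prefix_prob_ge0.

Lemma alphabet_gt0 : (0 < #|chi|)%N.
Proof.
have [w _] : [set: T] !=set0.
  apply/set0P/eqP => T0; have := probability_setT P.
  by rewrite T0 measure0 => /eqP; rewrite eqe eq_sym oner_eq0.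
by apply/card_gt0P; exists (X 0%N w).
Qed.

Lemma wentropy_cvg : cvgn (fun n => wentropy prefix_prob n / n%:R).
Proof.
apply: fekete => [n|n m]; first exact: (wentropy_ge0 _ prefix_prob_nil).
exact: (wentropyD _ prefix_prob_nil).
Qed.

(** [wentropy] is in nats, hence the factor [ln 2]. *)
Lemma entropyE : entropy P X = limn (fun n => wentropy prefix_prob n / n%:R) / ln 2.
Proof.
rewrite /entropy; apply: cvg_lim => //.
rewrite (_ : (fun n => _) = fun n => (wentropy prefix_prob n / n%:R) / ln 2).
  by apply: cvgM; [exact: wentropy_cvg|exact: cvg_cst].
apply/funext => n; rewrite mulrAC; congr (_ / _).
rewrite /block_entropy /wentropy mulNr; congr (- _); rewrite /wsum mulr_suml.
by apply: eq_bigr => t _; rewrite word_prob_prefix /log2 mulrA.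
Qed.

(** * Words heavy infinitely often, and ergodicity *)

Definition prob_often (a : nat -> R) : set (nat -> chi) :=
  [set x | forall N, exists2 n, (N <= n)%N & a n <= prefix_prob (mkseq x n)].

Lemma seq_measurable_prob_often a : seq_measurable (prob_often a).
Proof.
rewrite (_ : prob_often a = \bigcap_N \bigcup_n
    [set x | (N <= n)%N && (a n <= prefix_prob (mkseq x n))]).
  apply: seq_measurable_bigcap => N; apply: seq_measurable_bigcup => n.
  exact: (seq_measurable_prefix (fun s => (N <= n)%N && (a n <= prefix_prob s))).
apply/seteqP; split => x /= xa N => [_|].
  by have [n Nn pn] := xa N; exists n => //=; rewrite Nn.
by have [n _ /andP[Nn pn]] := xa N I; exists n.
Qed.

Lemma likely_mkseq (c : R) m (x : nat -> chi) L :
  likely prefix_prob c m (mkseq x L) <->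
  exists n, [/\ (m <= n)%N, (n <= L)%N &
                expR (- (c * n%:R)) <= prefix_prob (mkseq x n)].
Proof.
have tk n : (n <= L)%N -> take n (mkseq x L) = mkseq x n.
  by move=> nL; rewrite /mkseq -map_take take_iota (minn_idPl nL).
split=> [/existsP[[n /=] + /andP[mn]]|[n [mn nL pn]]].
  by rewrite size_mkseq ltnS => nL; rewrite tk// => pn; exists n.
apply/existsP; have nL' : (n < (size (mkseq x L)).+1)%N by rewrite size_mkseq.
by exists (Ordinal nL'); rewrite /= mn tk.
Qed.

(** A longer word has more prefixes, so the events [U n] decrease; their intersection misses an
    event of probability 1. Continuity from above concludes. *)
Lemma unlikely_prob_cvg0 (c : R) m :
  law P X (prob_often (fun n => expR (- (c * n%:R)))) = 1%E ->
  unlikely_prob prefix_prob c m n @[n --> \oo] --> 0.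
Proof.
rewrite /law; set G := realization X @^-1` _ => PG1.
have mG : measurable G.
  exact: measurable_realization (seq_measurable_prob_often _).
pose U n := [set w | ~~ likely prefix_prob c m (mkseq (x_ w) n)].
have mU n : measurable (U n).
  exact: (measurable_prefix (fun s => ~~ likely prefix_prob c m s)).
have UE n : P (U n) = (unlikely_prob prefix_prob c m n)%:E.
  exact: (wsum_prefix_prob n (fun s => ~~ likely prefix_prob c m s)).
have mI : measurable (\bigcap_n U n) by exact: bigcapT_measurable.
have PI : P (\bigcap_n U n) = 0%E.
  apply/eqP; rewrite -measure_le0.
  have -> : 0%E = P (~` G) by rewrite probability_setC// PG1 subee.
  apply: le_measure; rewrite ?inE//; first exact: measurableC.
  move=> w Uw Gw; have [n mn pn] := Gw m.
  by have /negP := Uw n I; apply; apply/likely_mkseq; exists n.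
have : P \o U @ \oo --> P (\bigcap_n U n).
  apply: nonincreasing_cvg_mu => //.
    by rewrite (le_lt_trans (probability_le1 P _))// ltry.
  move=> n k nk; apply/subsetPset => w; apply: contra => /likely_mkseq[i [mi ik pi]].
  by apply/likely_mkseq; exists i; split => //; exact: leq_trans nk.
rewrite PI (_ : P \o U = EFin \o unlikely_prob prefix_prob c m).
  by move/fine_cvgP => [_]; apply: cvg_trans; exact: cvg_id.
by apply/funext => n /=; rewrite UE.
Qed.

(* The constant factor [expR (- k)] makes [heavy_often c] forward invariant under
   the shift. *)
Definition heavy_often (c : R) : set (nat -> chi) :=
  \bigcup_k prob_often (fun n => expR (- (c * n%:R + k%:R))).

Lemma seq_measurable_heavy_often c : seq_measurable (heavy_often c).
Proof. by apply: seq_measurable_bigcup => k; exact: seq_measurable_prob_often. Qed.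

(** Dropping the first letter does not decrease the word probability, and the change of [c * n] by
    [c] is absorbed into the constant. *)
Lemma heavy_often_shift c x : 0 <= c ->
  heavy_often c x -> heavy_often c (Defs.shift x).
Proof.
move=> c0 [k _ xk]; exists (k + (Num.truncn c).+1)%N => // N.
have [[//|n] Nn pn] := xk N.+1; exists n => //.
apply: (@le_trans _ _ (prefix_prob (mkseq x n.+1))); last first.
  rewrite mkseq_shift -cat1s.
  exact: (prob_catr p_ge0 p_marginl).
apply: le_trans pn; rewrite ler_expR lerN2 -natr1 natrD.
have := ltW (truncnS_gt c); lra.
Qed.

Lemma law_iter_shift A j : seq_measurable A ->
  seq_measurable (iter j (@Defs.shift chi) @^-1` A) /\
  law P X (iter j (@Defs.shift chi) @^-1` A) = law P X A.
Proof.
move=> mA; elim: j => [//|j [mj <-]]; split.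
  rewrite (_ : _ @^-1` A = @Defs.shift chi @^-1` (iter j (@Defs.shift chi) @^-1` A)).
    exact: seq_measurable_shift.
  by apply/funext => x /=; rewrite -iterS iterSr.
rewrite -[RHS](X_stationary mj); congr (law P X _).
by apply/funext => x /=; rewrite -iterS iterSr.
Qed.

Hypothesis X_ergodic : ergodic P X.

(* Only [heavy_often c] `<=` shift^-1 [heavy_often c] holds, so ergodicity is
   applied to the increasing union of the iterated preimages, which is invariant
   and by stationarity has the same probability. *)
Lemma law_heavy_often c : 0 <= c ->
  law P X (heavy_often c) = 0%E \/ law P X (heavy_often c) = 1%E.
Proof.
move=> c0; pose F j := iter j (@Defs.shift chi) @^-1` heavy_often c.
have mF j := (law_iter_shift j (seq_measurable_heavy_often c)).1.
have PF j := (law_iter_shift j (seq_measurable_heavy_often c)).2.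
have FS x j : F j x -> F j.+1 x by rewrite /F /= => /heavy_often_shift; exact.
have mU : seq_measurable (\bigcup_j F j) by exact: seq_measurable_bigcup.
have <- : law P X (\bigcup_j F j) = law P X (heavy_often c).
  rewrite {1}/law preimage_bigcup.
  have mR j : measurable (realization X @^-1` F j) := measurable_realization (mF j).
  have /cvg_lim <- // :
      P \o (fun j => realization X @^-1` F j) @ \oo
        --> P (\bigcup_j (realization X @^-1` F j)).
    apply: nondecreasing_cvg_mu => //; first exact: bigcupT_measurable.
    by apply/nondecreasing_seqP => j; apply/subsetPset => w; exact: FS.
  by rewrite (_ : P \o _ = cst (law P X (heavy_often c))) ?lim_cst//; apply/funext.
apply: X_ergodic => //; apply/seteqP; split => x [j _ Fx].
  by exists j.+1 => //; rewrite /F /= -iterS iterSr.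
by exists j => //; have := FS _ _ Fx; rewrite /F /= -iterS iterSr.
Qed.

(** If the probability were 1, then, as [k <= e * n] for large [n], words would almost surely be
    heavy infinitely often at rate [c + e] without the constant, and [entropy_rate_le] would bound
    the entropy by [c + e] for every [e > 0]. *)
Lemma law_heavy_often0 c : 0 <= c -> c < entropy P X * ln 2 ->
  law P X (heavy_often c) = 0%E.
Proof.
move=> c0 cH; have [//|P1] := law_heavy_often c0.
suff : entropy P X * ln 2 <= c by rewrite leNgt cH.
rewrite entropyE divfK; last by rewrite gt_eqF// ln_gt0// ltr1n.
apply/ler_addgt0Pr => e e0.
apply: (entropy_rate_le p_ge0 prefix_prob_nil p_marginl p_marginr alphabet_gt0).
  by rewrite addr_ge0// ltW.
move=> m; apply: unlikely_prob_cvg0; apply/eqP; rewrite eq_le.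
rewrite probability_le1/=; last first.
  exact: measurable_realization (seq_measurable_prob_often _).
rewrite -P1; apply: le_measure; rewrite ?inE.
- exact: measurable_realization (seq_measurable_heavy_often c).
- exact: measurable_realization (seq_measurable_prob_often _).
- move=> w [k _ wk] N; have [n Nn pn] := wk (maxn N (Num.truncn (k%:R / e)).+1).
  move: Nn; rewrite geq_max => /andP[Nn kn]; exists n => //.
  apply: le_trans pn; rewrite ler_expR lerN2 mulrDl lerD2l.
  rewrite -ler_pdivrMl// mulrC (le_trans (ltW (truncnS_gt _)))//.
  by rewrite ler_nat.
Qed.

End source.

(** * Codeword lengths *)

Lemma card_short_codewords (chi : finType) (gamma : seq chi -> seq bool) n L :
  one_to_one_code gamma ->
  (#|[pred t : n.-tuple chi | (size (gamma t) <= L)%N]| <= 2 ^ L.+1)%N.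
Proof.
(* Pad to length [L.+1]; the first [true] ends the padding, so the codeword can be recovered. *)
move=> inj; pose pad (s : seq bool) := nseq (L - size s) false ++ true :: s.
have padK s : drop (index true (pad s)).+1 (pad s) = s.
  rewrite /pad index_cat mem_nseq andbF /= addn0 size_nseq.
  by rewrite -cat_rcons drop_size_cat// size_rcons size_nseq.
pose f (t : n.-tuple chi) : L.+1.-tuple bool :=
  insubd [tuple of nseq L.+1 false] (pad (gamma t)).
rewrite -{1}card_bool -card_tuple -(@card_in_imset _ _ f) ?max_card// => t u.
rewrite !inE => tL uL /(congr1 val); rewrite !val_insubd.
have sz (s : seq bool) : (size s <= L)%N -> size (pad s) == L.+1.
  by move=> sL; rewrite size_cat size_nseq /= addnS subnK.
rewrite !sz// => /(congr1 (fun s => drop (index true s).+1 s)).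
by rewrite !padK; exact: inj.
Qed.

Lemma limn_einf_ge (R : realType) (u : (\bar R)^nat) (l : \bar R) N :
  (forall n, (N <= n)%N -> (l <= u n)%E) -> (l <= limn_einf u)%E.
Proof.
move=> lu; rewrite limn_einf_lim; apply: lime_ge; first exact: is_cvg_einfs.
exists N => // n /= Nn; apply: le_ereal_inf_tmp => _ [k /= nk <-].
by apply: lu; exact: leq_trans nk.
Qed.

Section codelength.
Variables (R : realType) (d : measure_display) (T : measurableType d).
Variables (P : probability T R) (chi : finType) (X : nat -> T -> chi).
Hypotheses (X_source : is_source X) (X_stationary : stationary P X).
Hypothesis X_ergodic : ergodic P X.
Variable gamma : seq chi -> seq bool.
Hypothesis gamma_one_to_one : one_to_one_code gamma.
Variables a c : R.
Hypotheses (a_ge0 : 0 <= a) (a_lt_c : a < c).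

Let p := prefix_prob P X.

Definition short_rare n (s : seq chi) : bool :=
  ((size (gamma s))%:R * ln 2 <= a * n%:R) && (p s < expR (- (c * n%:R))).

(** A union bound: at most [2 ^ L.+1] words have a short codeword, each counted word has probability
    below [expR (- (c * n))], and [2 ^ L <= expR (a * n)]. *)
Lemma prob_short_rare n :
  (P [set w | short_rare n (mkseq (realization X w) n)] <=
   (2 * expR (a - c) ^+ n)%:E)%E.
Proof.
rewrite (wsum_prefix_prob _ X_source) lee_fin.
have ln2 : 0 < ln 2 :> R by rewrite ln_gt0// ltr1n.
set L := Num.truncn (a * n%:R / ln 2).
have an0 : 0 <= a * n%:R / ln 2 by rewrite divr_ge0 ?mulr_ge0// ltW.
apply: (@le_trans _ _ (wsum n (fun s : seq chi =>
    expR (- (c * n%:R)) * ((size (gamma s) <= L)%N)%:R))).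
  apply: ler_wsum => s _; rewrite /short_rare -/p.
  have [/=|_] := leP (_ * ln 2) _; last by rewrite mulr0 mulr_ge0 ?expR_ge0.
  rewrite -ler_pdivlMr// -truncn_ge_nat// => ->; rewrite mulr1.
  by case: ltP => [/ltW|]; rewrite ?mulr1 ?mulr0 ?expR_ge0.
rewrite wsumZ /wsum -natr_sum -big_mkcond /= sum1_card.
have := card_short_codewords n L gamma_one_to_one; rewrite -(ler_nat R) => cardL.
apply: le_trans (ler_wpM2l (expR_ge0 _) cardL) _.
rewrite expnS natrM mulrCA ler_pM2l// natrX.
have -> : 2 ^+ L = expR (L%:R * ln 2) :> R by rewrite expRM_natl lnK ?posrE.
rewrite -expRM_natl -expRD ler_expR.
have : L%:R <= a * n%:R / ln 2 by rewrite truncn_le.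
by rewrite ler_pdivlMr//; lra.
Qed.

Lemma codelength_gt : 0 <= c -> c < entropy P X * ln 2 ->
  {ae P, forall w, exists N, forall n, (N <= n)%N ->
    a * n%:R < (size (gamma (mkseq (realization X w) n)))%:R * ln 2}.
Proof.
move=> c0 cH.
pose E n := [set w | short_rare n (mkseq (realization X w) n)].
have mE n : measurable (E n) by exact: measurable_prefix.
have mh := measurable_realization X_source
  (seq_measurable_heavy_often P X c).
have h0 : P (realization X @^-1` heavy_often P X c) = 0%E.
  exact: law_heavy_often0.
have E0 : P (lim_sup_set E) = 0%E.
  apply: lim_sup_set_cvg0 => //.
  have z1 : 0 <= expR (a - c) < 1 by rewrite expR_ge0 expR_lt1 subr_lt0.
  apply: (@le_lt_trans _ _ (2 * (1 / (1 - expR (a - c))))%:E); last exact: ltry.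
  apply: lime_le; first by apply: is_cvg_nneseries => n _ _.
  apply: nearW => n.
  apply: (@le_trans _ _ (\sum_(0 <= k < n) (2 * expR (a - c) ^+ k)%:E)%E).
    by apply: lee_sum => k _; exact: prob_short_rare.
  rewrite sumEFin lee_fin -mulr_sumr ler_pM2l//.
  by rewrite -(expr0 (expR (a - c))) geometric_sum_le.
exists (realization X @^-1` heavy_often P X c `|` lim_sup_set E); split.
- apply: measurableU => //; apply: bigcapT_measurable => n.
  by apply: bigcup_measurable.
- apply: null_set_setU => //; apply: bigcapT_measurable => n.
  by apply: bigcup_measurable.
move=> w /= nw; apply: contrapT => /not_orP[nh nE]; apply: nw.
have [N1 HN1] : exists N, forall n, (N <= n)%N ->
    p (mkseq (realization X w) n) < expR (- (c * n%:R)).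
  (* Failure would put the realization in [heavy_often], with constant [k = 0]. *)
  apply: contrapT => H; apply: nh; exists 0%N => // N.
  apply: contrapT => H'; apply: H; exists N => n Nn.
  rewrite ltNge; apply/negP => pn; apply: H'; exists n => //.
  by rewrite addr0.
have [N2 HN2] : exists N, forall n, (N <= n)%N -> ~ E n w.
  apply: contrapT => H; apply: nE => N _.
  apply: contrapT => H'; apply: H; exists N => n Nn En.
  by apply: H'; exists n.
exists (maxn N1 N2) => n; rewrite geq_max => /andP[/HN1 pn /HN2 En].
by rewrite ltNge; apply/negP => sn; apply: En; rewrite /E /= /short_rare sn.
Qed.

End codelength.

(** * From rates below the entropy to the lower limit *)

Theorem theorem3 (R : realType) (d : measure_display) (T : measurableType d)
    (P : probability T R) (chi : finType) (X : nat -> T -> chi)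
    (X_source : is_source X)
    (X_stationary : stationary P X)
    (X_ergodic : ergodic P X)
    (gamma : seq chi -> seq bool)
    (gamma_one_to_one : one_to_one_code gamma) :
  {ae P, forall w : T,
    ((entropy P X)%:E <=
     limn_einf (fun n : nat =>
       ((size (gamma (mkseq (realization X w) n)))%:R / n%:R : R)%:E))%E}.
Proof.
have ln2 : 0 < ln 2 :> R by rewrite ln_gt0// ltr1n.
set H := entropy P X.
pose u (w : T) (n : nat) : \bar R :=
  ((size (gamma (mkseq (realization X w) n)))%:R / n%:R)%:E.
have rate (r : R) : r < H -> {ae P, forall w, (r%:E <= limn_einf (u w))%E}.
  move=> rH; have [r0|r0] := leP r 0.
    apply: aeW => w; apply: (@limn_einf_ge _ _ _ 0%N) => n _.
    by rewrite lee_fin (le_trans r0)// divr_ge0.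
  (* Strictly between [r * ln 2] and [H * ln 2]: the first gap gives summability, the second gives
     decay of word probabilities. *)
  pose c := (r + H) / 2 * ln 2.
  have rc : r * ln 2 < c by rewrite ltr_pM2r// /c; lra.
  have rl0 : 0 <= r * ln 2 by rewrite mulr_ge0// ltW.
  have := codelength_gt X_source X_stationary X_ergodic gamma_one_to_one rl0 rc.
  move=> /(_ (le_trans rl0 (ltW rc))).
  have cH : c < H * ln 2 by rewrite ltr_pM2r//; lra.
  move=> /(_ cH); apply: filterS => w [N HN].
  apply: (@limn_einf_ge _ _ _ N.+1) => n Nn; rewrite lee_fin.
  have n0 : 0 < n%:R :> R by rewrite ltr0n (leq_trans _ Nn).
  by rewrite ler_pdivlMr// -(ler_pM2r ln2) mulrAC ltW// HN// ltnW.
(* Countably many rates increasing to [H] share one null set. *)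
have : {ae P, forall w, forall k : nat, ((H - k.+1%:R^-1)%:E <= limn_einf (u w))%E}.
  by apply: ae_foralln => k; apply: rate; rewrite ltrBlDr ltrDl invr_gt0 ltr0n.
apply: filterS => w Hw; apply/lee_addgt0Pr => e e0.
have := Hw (Num.truncn e^-1); rewrite EFinB leeBlDr// => /le_trans; apply.
rewrite leeD2l// lee_fin -[leRHS]invrK lef_pV2 ?posrE ?invr_gt0//.
by rewrite ltW// truncnS_gt.
Qed.
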